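(* Computing the spherical depth of a query point in the plane takes $\Omega(n\log n)$ time in the algebraic decision tree model. That is, for every fixed degree bound $D\ge 1$ there is a constant $c>0$ such that, for all sufficiently large $n$, every algebraic decision tree of degree at most $D$ which on every input consisting of a query point $q\in\mathbb{R}^2$ and data points $x_1,\dots,x_n\in\mathbb{R}^2$ outputs $\mathrm{SphD}(q;(x_1,\dots,x_n))$ has depth at least $c\,n\log n$.
   Context: For $a,b\in\mathbb{R}^2$, the sphere area $\mathrm{Sph}(a,b)$ is the closed disk with diameter $\overline{ab}$: $\mathrm{Sph}(a,b)=\{t\in\mathbb{R}^2 : d(t,\frac{a+b}{2})\le \frac{d(a,b)}{2}\}$, where $d$ is the Euclidean distance. The spherical depth of $q\in\mathbb{R}^2$ with respect to the data $x_1,\dots,x_n\in\mathbb{R}^2$ ($n\ge 2$; the data points are given as a list and repetitions are allowed) is $$\mathrm{SphD}(q;(x_1,\dots,x_n))=\frac{1}{\binom n2}\,\bigl|\{(i,j): 1\le i<j\le n,\ q\in \mathrm{Sph}(x_i,x_j)\}\bigr|.$$ An algebraic decision tree of degree at most $D$ is a finite rooted ternary tree in which each internal node is labelled by a real polynomial of degree at most $D$ in the input coordinates, with the computation branching according to whether the value of the polynomial at the input is negative, zero or positive, and in which each leaf is labelled by the output value. The depth is the maximum number of internal nodes on a root-to-leaf path. *)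

(* Defs.v *)
From HB Require Import structures.
From mathcomp Require Import all_boot all_order all_algebra.
From mathcomp Require Import mpoly.

Set Implicit Arguments.
Unset Strict Implicit.
Unset Printing Implicit Defensive.

Import Order.TTheory GRing.Theory Num.Theory.
Local Open Scope ring_scope.

Section SphericalDepth.
Variable R : rcfType.

(* The norm that MathComp-Analysis puts on matrices is the sup norm, hence
   this explicit Euclidean distance. *)
Definition edist (a b : 'rV[R]_2) : R :=
  Num.sqrt (\sum_(k < 2) (a 0 k - b 0 k) ^+ 2).

Definition Sph (a b : 'rV[R]_2) : {pred 'rV[R]_2} :=
  [pred t | edist t (2^-1 *: (a + b)) <= edist a b / 2].

Definition SphD (n : nat) (q : 'rV[R]_2) (x : 'I_n -> 'rV[R]_2) : R :=
  #|[set ij : 'I_n * 'I_n | (ij.1 < ij.2)%N & q \in Sph (x ij.1) (x ij.2)]|%:R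
  / 'C(n, 2)%:R.

(* Input coordinates in the order q_0, q_1, x_00, x_01, x_10, x_11, etc. *)
Definition input_coords (n : nat) (q : 'rV[R]_2) (x : 'I_n -> 'rV[R]_2) :
    'I_((1 + n) * 2) -> R :=
  mxvec (col_mx q (\matrix_(i < n) x i)) 0.

End SphericalDepth.

(* The three subtrees of a node correspond, in this order, to a negative, zero
   and positive value of its polynomial. *)
Inductive adtree (R : rcfType) (m : nat) : Type :=
| ADLeaf of R
| ADNode of {mpoly R[m]} & adtree R m & adtree R m & adtree R m.

Section AlgebraicDecisionTrees.
Variables (R : rcfType) (m : nat).

Fixpoint adtree_eval (T : adtree R m) (v : 'I_m -> R) : R :=
  match T with
  | ADLeaf r => r
  | ADNode p Tneg Tzero Tpos =>
      if p.@[v] < 0 then adtree_eval Tneg v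
      else if p.@[v] == 0 then adtree_eval Tzero v
      else adtree_eval Tpos v
  end.

Fixpoint adtree_depth (T : adtree R m) : nat :=
  match T with
  | ADLeaf _ => 0
  | ADNode _ Tneg Tzero Tpos =>
      (maxn (adtree_depth Tneg)
            (maxn (adtree_depth Tzero) (adtree_depth Tpos))).+1
  end.

(* msize p is the total degree of p plus one (and 0 for p = 0). *)
Fixpoint adtree_degree_le (D : nat) (T : adtree R m) : bool :=
  match T with
  | ADLeaf _ => true
  | ADNode p Tneg Tzero Tpos =>
      [&& (msize p <= D.+1)%N, adtree_degree_le D Tneg,
          adtree_degree_le D Tzero & adtree_degree_le D Tpos]
  end.

End AlgebraicDecisionTrees.

(* Main.v *)
(* The spherical depth of the origin in a configuration built from the points
   (a_i, 1) and (-1, a_j) counts the pairs with a_j <= a_i, hence detects whether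
   the a_i > 0 are distinct. The tree is run on the m! inputs a_i = t^(y_i) with
   y_i = (D+1)^(s i), s a permutation and t large: a polynomial of degree at most
   D then takes the sign of its unique y-heaviest monomial. Suppose s and s' reach
   the same leaf and the products of the polynomials on the path have the same
   heaviest monomial. Then each of these polynomials has the same heaviest monomial
   for s and s', hence also for every nonnegative combination of the two weights,
   and some such combination has y_i = y_j with i <> j; this input reaches the same
   leaf, although its a_i are not distinct. The product on a path of length at most
   h has degree at most D h, so m! <= 3^h C(m + D h, m). *)
Require Import Defs.
From mathcomp Require Import all_boot all_order all_algebra all_fingroup.
From mathcomp Require Import mpoly.
From mathcomp Require Import reals exp.
From mathcomp Require Import zify lra.

Set Implicit Arguments.
Unset Strict Implicit.
Unset Printing Implicit Defensive.

Import Order.TTheory GRing.Theory Num.Theory.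
Local Open Scope ring_scope.

(** * Counting lemmas on sums, digits and monomials of bounded degree *)

Lemma eq_leq_sum (T : eqType) (s : seq T) (F G : T -> nat) :
  {in s, forall x, F x <= G x}%N ->
  (\sum_(x <- s) F x = \sum_(x <- s) G x)%N -> {in s, F =1 G}.
Proof.
elim: s => [|x s IHs] // leFG; rewrite !big_cons.
have lex := leFG _ (mem_head x s).
have les : {in s, forall y, F y <= G y}%N.
  by move=> y ys; apply: leFG; rewrite inE ys orbT.
have leS : (\sum_(y <- s) F y <= \sum_(y <- s) G y)%N.
  by rewrite big_seq [leqRHS]big_seq leq_sum.
move=> eqs; have eqx : F x = G x by lia.
by move=> y; rewrite inE => /predU1P[-> //|]; apply: IHs => //; lia.
Qed.

(** Reduction modulo [B] recovers the lowest digit; cancel it, divide by [B] and iterate. *)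
Lemma expn_digits_inj (B n : nat) (f g : 'I_n -> nat) :
  (forall i, f i < B)%N -> (forall i, g i < B)%N ->
  (\sum_(i < n) f i * B ^ i = \sum_(i < n) g i * B ^ i)%N -> f =1 g.
Proof.
elim: n f g => [|n IHn] f g ltf ltg; first by move=> _ [].
have shift h : (\sum_(i < n.+1) h i * B ^ i =
    h ord0 + (\sum_(i < n) h (lift ord0 i) * B ^ i) * B)%N.
  rewrite big_ord_recl muln1 big_distrl; congr addn.
  by apply: eq_bigr => i _; rewrite lift0 expnSr mulnA.
rewrite !shift => eqfg.
have B_gt0 : (0 < B)%N by apply: leq_ltn_trans (ltf ord0).
have eq0 : f ord0 = g ord0.
  have := congr1 (modn^~ B) eqfg.
  by rewrite /= ![(_ + _ * B)%N]addnC !modnMDl !modn_small.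
have eqS : {in xpredT, (f \o lift ord0) =1 g \o lift ord0}.
  move=> i _; apply: IHn => // [k|k|]; [exact: ltf|exact: ltg|].
  by move: eqfg; rewrite eq0 => /addnI/eqP; rewrite eqn_pmul2r // => /eqP.
by move=> i; case: (unliftP ord0 i) => [j ->|-> //]; apply: eqS.
Qed.

Lemma leq_bin_exp2 n k : ('C(n, k) <= 2 ^ n)%N.
Proof.
elim: n k => [|n IHn] [|k] //; first by rewrite bin0 expn_gt0.
by rewrite binS expnS mul2n -addnn leq_add.
Qed.

(** ['C(m + K, m)] counts the exponent vectors of degree at most [K] in [m] variables. On [S] each
    exponent is at most [K], so [inord] loses nothing. *)
Lemma card_mdeg_le (m K : nat) (I : finType) (S : {set I}) (f : I -> 'X_{1..m}) :
  {in S, forall i, mdeg (f i) <= K}%N -> {in S &, injective f} ->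
  (#|S| <= 'C(m + K, m))%N.
Proof.
move=> degf injf; rewrite -card_partial_ord_partitions.
pose g i : m.-tuple 'I_K.+1 := [tuple inord (f i k) | k < m].
have valg i k : i \in S -> tnth (g i) k = f i k :> nat.
  move=> iS; rewrite tnth_mktuple inordK // ltnS; apply: leq_trans (degf _ iS).
  by rewrite mdegE (bigD1 k) //= leq_addr.
have injg : {in S &, injective g}.
  by move=> i j iS jS eqg; apply: injf => //; apply/mnmP => k; rewrite -!valg ?eqg.
rewrite -(card_in_imset injg); apply/subset_leq_card/subsetP => _ /imsetP[i iS ->].
rewrite inE big_tuple (eq_bigr (fun k => f i k)); last by move=> k _; rewrite valg.
by rewrite -mdegE degf.
Qed.

(** * Signs of polynomials along the curves [powers t y] for large [t] *)

Section LeadingMonomials.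
Variables (R : rcfType) (m : nat).
Implicit Types (p : {mpoly R[m]}) (y : 'I_m -> nat) (u v : 'X_{1..m}).

(** The exponent of [t] in the value of the monomial [u] at [powers t y]. *)
Definition weight y u : nat := (\sum_i u i * y i)%N.

Definition powers (t : R) y (i : 'I_m) : R := t ^+ y i.

Lemma meval_powers p y t :
  p.@[powers t y] = \sum_(u <- msupp p) p@_u * t ^+ weight y u.
Proof.
rewrite mevalE; apply: eq_bigr => u _; congr (_ * _).
by rewrite /weight -prodrXr; apply: eq_bigr => i _; rewrite -exprM mulnC.
Qed.

Lemma weight_sum (T : Type) (s : seq T) (F : T -> 'X_{1..m}) y :
  weight y (\sum_(x <- s) F x)%MM = (\sum_(x <- s) weight y (F x))%N.
Proof.
rewrite /weight exchange_big; apply: eq_bigr => i _.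
by rewrite mnm_sumE big_distrl.
Qed.

Lemma weight_comb (a b : nat) y z u :
  weight (fun i => a * y i + b * z i)%N u = (a * weight y u + b * weight z u)%N.
Proof.
rewrite /weight !big_distrr -big_split; apply: eq_bigr => i _ /=.
by rewrite mulnDr !(mulnCA (u i)).
Qed.

(** Vacuous for [p = 0], so identically zero tests are treated like the others. *)
Definition dominates y p u :=
  {in msupp p, forall v, v != u -> (weight y v < weight y u)%N}.

(** Weights are linear in [y], and the strict inequalities survive because one coefficient is
    positive. *)
Lemma dominates_comb (a b : nat) y z p u :
  (0 < a + b)%N -> dominates y p u -> dominates z p u ->
  dominates (fun i => a * y i + b * z i)%N p u.
Proof.
move=> ab domy domz v vp neq; rewrite !weight_comb.
have := domy v vp neq; have := domz v vp neq.
by case: a ab => [|a] ab; nia.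
Qed.

(** The term of [u] outgrows the sum of all others. The first hypothesis puts [u] in the support
    unless [p = 0], where both signs are 0. *)
Lemma sgr_meval_powers p y u :
  (p@_u = 0 -> p = 0) -> dominates y p u ->
  exists t0 : R, forall t, t0 <= t -> Num.sg p.@[powers t y] = Num.sg p@_u.
Proof.
move=> pu0 dom; case: (eqVneq p@_u 0) => [/[dup] /pu0 -> _|pu].
  by exists 0 => t _; rewrite meval0 mcoeff0.
have up : u \in msupp p by rewrite mcoeff_msupp.
pose C := \sum_(v <- msupp p | v != u) `|p@_v|.
have C_ge0 : 0 <= C by apply: sumr_ge0.
have apu : 0 < `|p@_u| by rewrite normr_gt0.
(* The summand 1 gives [1 <= t] and makes [C < |p@_u| * t] strict. *)
exists (1 + C / `|p@_u|) => t le_t.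
have t_ge1 : 1 <= t by apply: le_trans le_t; rewrite lerDl divr_ge0 // ltW.
have t_gt0 : 0 < t by apply: lt_le_trans t_ge1.
have Ct : C < `|p@_u| * t.
  by rewrite mulrC -ltr_pdivrMr //; apply: lt_le_trans le_t; lra.
rewrite meval_powers (bigD1_seq u) //=; set rest := bigop _ _ _.
suff ltrest : `|rest| < `|p@_u * t ^+ weight y u|.
  have sgD (a b : R) : `|b| < `|a| -> Num.sg (a + b) = Num.sg a.
    case: (ltgtP 0 a) => [a_gt0|a_lt0|<-]; last by rewrite normr0 normr_lt0.
      rewrite (gtr0_norm a_gt0) ltr_norml => /andP[? ?].
      by rewrite !gtr0_sg //; lra.
    rewrite (ltr0_norm a_lt0) ltr_norml => /andP[? ?].
    by rewrite !ltr0_sg //; lra.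
  by rewrite sgD // sgrM (gtr0_sg (exprn_gt0 _ t_gt0)) mulr1.
rewrite normrM (gtr0_norm (exprn_gt0 _ t_gt0)).
(* If [C = 0] nothing else remains. Otherwise some monomial has smaller weight, so the weight of [u]
   is some [k.+1] and the rest is at most [C * t ^+ k]. *)
have [C0|Cn0] := eqVneq C 0.
  rewrite (_ : rest = 0) ?normr0 ?mulr_gt0 ?exprn_gt0 //.
  rewrite /rest big1_seq // => v /andP[vu vp].
  move/eqP: C0; rewrite psumr_eq0 // => /allP/(_ v vp)/implyP/(_ vu).
  by rewrite normr_eq0 => /eqP->; rewrite mul0r.
have [k wk] : exists k, weight y u = k.+1.
  case E : (weight y u) => [|k]; last by exists k.
  case/negP: Cn0; apply/eqP; rewrite /C big1_seq // => v /andP[vu vp].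
  by have := dom _ vp vu; rewrite E.
rewrite wk exprS mulrA; apply: le_lt_trans (_ : C * t ^+ k < _); last first.
  by rewrite ltr_pM2r ?exprn_gt0.
rewrite /C mulr_suml; apply: le_trans (ler_norm_sum _ _ _) _.
rewrite big_seq_cond [leRHS]big_seq_cond; apply: ler_sum => v /andP[vp vu].
rewrite normrM (gtr0_norm (exprn_gt0 _ t_gt0)) ler_wpM2l //.
by rewrite ler_weXn2l // -ltnS -wk dom.
Qed.

(** A heaviest monomial of [p], taken from the support sorted by decreasing weight; the default for
    [p = 0] is the monomial 1. *)
Definition lead y p : 'X_{1..m} :=
  head 0%MM (sort (relpre (weight y) geq) (msupp p)).

Lemma lead_mem y p : p != 0 -> lead y p \in msupp p.
Proof.
rewrite -msupp_eq0 /lead -(mem_sort (relpre (weight y) geq)) -!size_eq0.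
by rewrite -(size_sort (relpre (weight y) geq)); case: sort => //= u s _; rewrite mem_head.
Qed.

Lemma lead0 y : lead y 0 = 0%MM.
Proof. by rewrite /lead msupp0. Qed.

Lemma mcoeff_lead_eq0 y p : p@_(lead y p) = 0 -> p = 0.
Proof.
by apply: contra_eq => /(lead_mem y); rewrite mcoeff_msupp.
Qed.

Lemma weight_lead y p : {in msupp p, forall v, weight y v <= weight y (lead y p)}%N.
Proof.
move=> v; rewrite /lead -(mem_sort (relpre (weight y) geq)).
have tot : total (relpre (weight y) geq) by move=> a b; apply: leq_total.
have := sort_sorted tot (msupp p); case: sort => //= u s.
rewrite path_sortedE; last by move=> a b c /= ba ac; apply: leq_trans ac ba.
by case/andP=> /allP les _; rewrite inE => /predU1P[->|/les].
Qed.


(** * Counting the weight vectors that reach a leaf *)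

Section LeafCount.
Variables (D : nat) (I : finType) (Y : I -> 'I_m -> nat) (T0 : adtree R m).

Hypothesis weight_inj : forall i u v,
  (mdeg u <= D)%N -> (mdeg v <= D)%N -> weight (Y i) u = weight (Y i) v -> u = v.

(** This forbids [i] and [j] to share both a leaf and all leading monomials on its path, since the
    combination would then reach that leaf too. *)
Hypothesis separated : forall i j, i != j ->
  exists a b : nat, (0 < a + b)%N /\ forall t0 : R, exists2 t, t0 <= t &
    adtree_eval T0 (powers t (Y i)) <>
    adtree_eval T0 (powers t (fun k => a * Y i k + b * Y j k)%N).

Lemma mdeg_lead y p : (msize p <= D.+1)%N -> (mdeg (lead y p) <= D)%N.
Proof.
move=> szp; have [->|/(lead_mem y)/msize_mdeg_lt ltp] := eqVneq p 0.
  by rewrite lead0 mdeg0.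
by rewrite -ltnS (leq_trans ltp).
Qed.

Lemma dominates_lead i p : (msize p <= D.+1)%N -> dominates (Y i) p (lead (Y i) p).
Proof.
move=> szp v vp neqv; rewrite ltn_neqAle weight_lead // andbT.
apply: contraNneq neqv => /weight_inj-> //; last exact: mdeg_lead.
by rewrite -ltnS (leq_trans (msize_mdeg_lt vp)).
Qed.

Lemma weight_lead_cross i j p :
  (weight (Y i) (lead (Y j) p) <= weight (Y i) (lead (Y i) p))%N.
Proof.
by have [->|/(lead_mem (Y j))/weight_lead->//] := eqVneq p 0; rewrite !lead0.
Qed.

(* The exponent of the leading monomial of the product of [ps] determines that
   of each factor: at the weights [Y i] every factor is maximised by its own. *)
Lemma lead_sum_inj (ps : seq {mpoly R[m]}) i j :
  {in ps, forall p, msize p <= D.+1}%N ->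
  (\sum_(p <- ps) lead (Y i) p = \sum_(p <- ps) lead (Y j) p)%MM ->
  {in ps, lead (Y i) =1 lead (Y j)}.
Proof.
move=> szps /(congr1 (weight (Y i))); rewrite !weight_sum => /esym eqS p pps.
apply/esym/(@weight_inj i); try by apply: mdeg_lead; apply: szps.
exact: (eq_leq_sum (fun q _ => weight_lead_cross i j q) eqS).
Qed.

Lemma mdeg_sum_lead y (ps : seq {mpoly R[m]}) :
  {in ps, forall p, msize p <= D.+1}%N ->
  (mdeg (\sum_(p <- ps) lead y p)%MM <= D * size ps)%N.
Proof.
elim: ps => [|p ps IHps] szps; first by rewrite big_nil mdeg0.
rewrite big_cons mdegD mulnS leq_add ?mdeg_lead ?szps ?mem_head //.
by apply: IHps => q qps; rewrite szps // inE qps orbT.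
Qed.

(** For large [t], the tests [ps] then have the same signs at [powers t y] as at [powers t (Y i)].
    The vector [y] may lie outside the family [Y], as the combinations in [separated] do. *)
Definition follows (ps : seq {mpoly R[m]}) i y :=
  {in ps, forall p, dominates y p (lead (Y i) p)}.

(** The leading exponent of the product of [ps] is injective on [S]: in a collision the two indices
    have the same leading monomials, so their combination also yields [r], against [separated]. *)
Lemma card_leaf (r : R) (ps : seq {mpoly R[m]}) (S : {set I}) :
  {in ps, forall p, msize p <= D.+1}%N ->
  (forall i y, i \in S -> follows ps i y -> exists t0 : R, forall t, t0 <= t ->
     adtree_eval T0 (powers t y) = r) ->
  (#|S| <= 'C(m + D * size ps, m))%N.
Proof.
move=> szps evalT0.
apply: (@card_mdeg_le m _ I S (fun i => \sum_(p <- ps) lead (Y i) p)%MM) => [i _|i j iS jS].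
  exact: mdeg_sum_lead.
move=> /(lead_sum_inj szps) eql; apply/eqP/negPn/negP => /separated[a [b [ab sep]]].
have domi : follows ps i (Y i) by move=> p /szps; apply: dominates_lead.
have domj : follows ps i (Y j).
  by move=> p pps; rewrite eql //; apply: dominates_lead; apply: szps.
have domij : follows ps i (fun k => a * Y i k + b * Y j k)%N.
  by move=> p pps; apply: dominates_comb ab (domi p pps) (domj p pps).
have [ti Hi] := evalT0 _ _ iS domi; have [tij Hij] := evalT0 _ _ iS domij.
have [t le_t] := sep (Num.max ti tij); apply.
by move: le_t; rewrite ge_max => /andP[? ?]; rewrite Hi ?Hij.
Qed.

(** Here [S] holds the indices that arrive at the subtree [T] after the tests [ps]. A node splits
    [S] by the sign of the leading coefficient, whence the factor 3, and moves its polynomial into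
    [ps]. The evaluation hypothesis ranges over all [y] that follow, because the leaves need it for
    combinations. *)
Lemma card_subtree (T : adtree R m) (ps : seq {mpoly R[m]}) (S : {set I}) :
  adtree_degree_le D T ->
  {in ps, forall p, msize p <= D.+1}%N ->
  (forall i y, i \in S -> follows ps i y -> exists t0 : R, forall t, t0 <= t ->
     adtree_eval T0 (powers t y) = adtree_eval T (powers t y)) ->
  (#|S| <= 3 ^ adtree_depth T * 'C(m + D * (size ps + adtree_depth T), m))%N.
Proof.
elim: T ps S => [r|p T1 IH1 T2 IH2 T3 IH3] ps S.
  by move=> _ szps evalT0; rewrite mul1n addn0; apply: (card_leaf szps evalT0).
move=> /and4P[szp deg1 deg2 deg3] szps evalT0.
pose branch (c : R) := [set i in S | Num.sg p@_(lead (Y i) p) == c].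
pose d := maxn (adtree_depth T1) (maxn (adtree_depth T2) (adtree_depth T3)).
have szpps : {in p :: ps, forall q, msize q <= D.+1}%N.
  by move=> q; rewrite inE => /predU1P[->|/szps].
have card_branch c T :
    (forall ps (S : {set I}), adtree_degree_le D T ->
       {in ps, forall p, msize p <= D.+1}%N ->
       (forall i y, i \in S -> follows ps i y -> exists t0 : R, forall t, t0 <= t ->
         adtree_eval T0 (powers t y) = adtree_eval T (powers t y)) ->
       (#|S| <= 3 ^ adtree_depth T * 'C(m + D * (size ps + adtree_depth T), m))%N) ->
    adtree_degree_le D T -> (adtree_depth T <= d)%N ->
    (forall x, Num.sg p.@[x] = c ->
       adtree_eval (ADNode p T1 T2 T3) x = adtree_eval T x) ->
    (#|branch c| <= 3 ^ d * 'C(m + D * (size ps + d.+1), m))%N.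
  move=> IH degT leT evalT; apply: leq_trans (IH (p :: ps) _ degT szpps _) _.
    move=> i y; rewrite inE => /andP[iS /eqP sgi] fol.
    have [|t1 Ht1] := evalT0 i y iS.
      by move=> q qps; apply: fol; rewrite inE qps orbT.
    (* The monomial leading at [Y i] also dominates at [y], so its coefficient decides the branch
       there. *)
    have [t2 Ht2] := sgr_meval_powers (@mcoeff_lead_eq0 (Y i) p) (fol p (mem_head _ _)).
    exists (Num.max t1 t2) => t; rewrite ge_max => /andP[le1 le2].
    by rewrite Ht1 //; apply: evalT; rewrite Ht2.
  rewrite leq_mul ?leq_pexp2l ?leq_bin2l //= leq_add2l leq_mul2l.
  by rewrite addSnnS leq_add2l ltnS leT orbT.
have S_sub : S \subset branch (-1) :|: (branch 0 :|: branch 1).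
  apply/subsetP => i iS; rewrite !inE iS /=.
  by case: sgrP; rewrite !eqxx ?orbT.
apply: leq_trans (subset_leq_card S_sub) _.
apply: leq_trans (leq_card_setU _ _) _.
apply: leq_trans (leq_add (leqnn _) (leq_card_setU _ _)) _.
rewrite [adtree_depth _]/= -/d expnS -mulnA mulSn mul2n -addnn.
apply: leq_add; last apply: leq_add.
- apply: (card_branch _ T1) => // [|v /eqP]; first by rewrite leq_maxl.
  by rewrite sgr_cp0 /= => ->.
- apply: (card_branch _ T2) => // [|v /eqP]; first by rewrite !leq_max leqnn orbT.
  by rewrite sgr_cp0 /= => /eqP->; rewrite ltxx eqxx.
- apply: (card_branch _ T3) => // [|v /eqP]; first by rewrite !leq_max leqnn !orbT.
  by rewrite sgr_cp0 /= => pv; rewrite ltNge ltW //= gt_eqF.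
Qed.

Lemma card_weights :
  adtree_degree_le D T0 ->
  (#|I| <= 3 ^ adtree_depth T0 * 'C(m + D * adtree_depth T0, m))%N.
Proof.
move=> degT; rewrite -cardsT; apply: (@card_subtree T0 [::]) => //.
by move=> i y _ _; exists 0.
Qed.

End LeafCount.

End LeadingMonomials.

(** * Weight vectors from permutations *)

Section Permutations.
Variables (R : rcfType) (m D : nat).
Hypothesis D_gt0 : (0 < D)%N.

Definition perm_weights (s : {perm 'I_m}) (i : 'I_m) : nat := (D.+1 ^ s i)%N.

(** In base [D.+1] the digits of the weight are the exponents, permuted by [s]. *)
Lemma perm_weights_inj s (u v : 'X_{1..m}) :
  (mdeg u <= D)%N -> (mdeg v <= D)%N ->
  weight (perm_weights s) u = weight (perm_weights s) v -> u = v.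
Proof.
have digit (w : 'X_{1..m}) i : (mdeg w <= D)%N -> (w i < D.+1)%N.
  by rewrite ltnS; apply: leq_trans; rewrite mdegE (bigD1 i) //= leq_addr.
have weightE w : weight (perm_weights s) w = (\sum_i w ((s^-1)%g i) * D.+1 ^ i)%N.
  rewrite /weight (reindex_inj (@perm_inj _ (s^-1)%g)).
  by apply: eq_bigr => i _; rewrite /perm_weights permKV.
move=> degu degv; rewrite !weightE => /expn_digits_inj equv.
apply/mnmP => i; rewrite -(permK s i).
by apply: equv => j; apply: digit.
Qed.

(** Take the least value [k] whose preimages [i] under [s] and [j] under [t] differ. Values below
    [k] are attained at the same places by both, so [s j] and [t i] exceed [k]. *)
Lemma perm_neq_inversion (s t : {perm 'I_m}) : s != t ->
  exists i j, (s i < s j)%N /\ (t j < t i)%N.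
Proof.
move=> neq_st; pose differ := [pred k | (s^-1)%g k != (t^-1)%g k].
have [k0 k0P] : exists k, differ k.
  apply/existsP; apply: contraNT neq_st; rewrite negb_exists => /forallP eq_st.
  by apply/eqP/invg_inj/permP => k; apply/eqP/negPn/eq_st.
case: (arg_minnP (fun k : 'I_m => k : nat) k0P) => k dk mink.
have above (s1 t1 : {perm 'I_m}) : (s1^-1)%g k != (t1^-1)%g k ->
    (forall j : 'I_m, j < k -> (s1^-1)%g j = (t1^-1)%g j)%N ->
    (k < s1 ((t1^-1)%g k))%N.
  move=> neqk eq_below; rewrite ltn_neqAle leqNgt; apply/andP; split.
    by apply: contraNneq neqk => /val_inj eqk; rewrite [in X in X == _]eqk permK.
  apply/negP => /[dup] lts /eq_below; rewrite permK => /(congr1 t1).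
  by rewrite !permKV => eqk; rewrite -eqk ltnn in lts.
have below (j : 'I_m) : (j < k)%N -> (s^-1)%g j = (t^-1)%g j.
  by move=> ltj; apply/eqP/negPn/negP => /mink; rewrite leqNgt ltj.
exists ((s^-1)%g k), ((t^-1)%g k); rewrite !permKV; split; apply: above => //.
  by rewrite eq_sym.
by move=> j /below.
Qed.

Lemma fact_le_distinctness_tree (T : adtree R m) :
  adtree_degree_le D T ->
  (forall a b : 'I_m -> R, (forall i, 0 < a i) -> (forall i, 0 < b i) ->
     injective a -> ~ injective b -> adtree_eval T a <> adtree_eval T b) ->
  (m`! <= 3 ^ adtree_depth T * 'C(m + D * adtree_depth T, m))%N.
Proof.
move=> degT sepT; rewrite -card_Sn.
apply: (card_weights (Y := perm_weights)) => // [s u v|s t neq_st].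
  exact: perm_weights_inj.
have [i [j [ltij ltji]]] := perm_neq_inversion neq_st.
(* These coefficients make the combined weights at [i] and [j] equal; the inversion makes both
   differences positive. *)
pose a := (perm_weights t i - perm_weights t j)%N.
pose b := (perm_weights s j - perm_weights s i)%N.
have a_gt0 : (0 < a)%N by rewrite subn_gt0 ltn_exp2l.
have b_gt0 : (0 < b)%N by rewrite subn_gt0 ltn_exp2l.
exists a, b; split; first by rewrite addn_gt0 a_gt0.
(* A base above 1 has distinct powers, so the input of [s] is injective. *)
move=> t0; exists (Num.max t0 2); first by rewrite le_max lexx.
have t_gt1 : 1 < Num.max t0 2 by rewrite lt_max ltr1n orbT.
have pos y k : 0 < powers (Num.max t0 2) y k :> R.
  by rewrite exprn_gt0 // (lt_trans ltr01).
apply: sepT => // [k l /(ieexprIn (lt_trans ltr01 t_gt1) (negbT (gt_eqF t_gt1)))|].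
  by move/(expnI (D_gt0 : 1 < D.+1)%N)/val_inj/perm_inj.
move=> inj; have /inj eqij : powers (Num.max t0 2)
   (fun k => a * perm_weights s k + b * perm_weights t k)%N i =
   powers (Num.max t0 2) (fun k => a * perm_weights s k + b * perm_weights t k)%N j :> R.
  congr (_ ^+ _); move: a_gt0 b_gt0; rewrite /a /b !subn_gt0; nia.
by rewrite eqij ltnn in ltij.
Qed.

End Permutations.

(** * Substituting polynomials of degree at most one into a tree *)

Section Composition.
Variables (R : rcfType) (N m : nat) (lq : N.-tuple {mpoly R[m]}).

Lemma msizeM_leD a b (p q : {mpoly R[m]}) :
  (msize p <= a.+1 -> msize q <= b.+1 -> msize (p * q)%R <= (a + b).+1)%N.
Proof.
have [->|p0] := eqVneq p 0; first by rewrite mul0r msize0.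
have [->|q0] := eqVneq q 0; first by rewrite mulr0 msize0.
rewrite msizeM // => lea leb.
by rewrite -subn1 leq_subLR add1n -addSn -addnS leq_add.
Qed.

Lemma msize_comp_mpoly D (p : {mpoly R[N]}) :
  (forall i, msize (tnth lq i) <= 2)%N -> (msize p <= D.+1)%N ->
  (msize (p \mPo lq) <= D.+1)%N.
Proof.
move=> lq_le szp; rewrite comp_mpolyEX.
apply: leq_trans (msize_sum _ _ _) _; rewrite big_seq; apply/bigmax_leqP_seq => u _ up.
have degu : (mdeg u <= D)%N by rewrite -ltnS (leq_trans (msize_mdeg_lt up)).
rewrite -mul_mpolyC -[D]add0n; apply: msizeM_leD.
  by rewrite msizeC; case: eqP.
rewrite comp_mpolyX; apply: leq_trans (_ : (mdeg u).+1 <= _)%N; last by rewrite ltnS.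
rewrite mdegE; elim/big_rec2: _ => [|i d q _ szq].
  by rewrite msizeC; case: eqP.
apply: msizeM_leD => //; elim: (u i) => [|k IHk].
  by rewrite expr0 msizeC; case: eqP.
by rewrite exprS (@msizeM_leD 1).
Qed.

(** Runs [T] on the inputs parametrised by [lq], so that a lower bound on the restricted problem
    transfers to [T]. *)
Fixpoint adtree_comp (T : adtree R N) : adtree R m :=
  match T with
  | ADLeaf r => ADLeaf m r
  | ADNode p T1 T2 T3 =>
      ADNode (p \mPo lq) (adtree_comp T1) (adtree_comp T2) (adtree_comp T3)
  end.

Lemma adtree_eval_comp T v :
  adtree_eval (adtree_comp T) v = adtree_eval T (fun i => (tnth lq i).@[v]).
Proof. by elim: T => //= p T1 -> T2 -> T3 ->; rewrite comp_mpoly_meval. Qed.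

Lemma eq_adtree_eval k (T : adtree R k) (v w : 'I_k -> R) :
  v =1 w -> adtree_eval T v = adtree_eval T w.
Proof.
move=> eq_vw; elim: T => //= p T1 -> T2 -> T3 ->.
by rewrite (meval_eq _ eq_vw).
Qed.

Lemma adtree_depth_comp T : adtree_depth (adtree_comp T) = adtree_depth T.
Proof. by elim: T => //= p T1 -> T2 -> T3 ->. Qed.

Lemma adtree_degree_comp D T : (forall i, msize (tnth lq i) <= 2)%N ->
  adtree_degree_le D T -> adtree_degree_le D (adtree_comp T).
Proof.
move=> lq_le; elim: T => //= p T1 IH1 T2 IH2 T3 IH3 /and4P[szp d1 d2 d3].
by rewrite msize_comp_mpoly ?IH1 ?IH2 ?IH3.
Qed.

End Composition.

(** * Spherical depth of the origin and the gadget configuration *)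

Section Geometry.
Variable R : rcfType.

(** Thales: after squaring, [|u + v| <= |u - v|] says that the inner product is at most 0. *)
Lemma in_Sph0 (u v : 'rV[R]_2) :
  (0 \in Sph u v) = (\sum_(k < 2) u 0 k * v 0 k <= 0).
Proof.
have half (x : R) : Num.sqrt x / 2 = Num.sqrt (x / 2 ^+ 2).
  have [x_ge0|/ltW x_le0] := leP 0 x.
    by rewrite sqrtrM // -exprVn sqrtr_sqr ger0_norm // invr_ge0.
  by rewrite !ler0_sqrtr ?mul0r // mulr_le0_ge0 // invr_ge0 sqr_ge0.
rewrite inE /edist half ler_sqrt; last first.
  by rewrite divr_ge0 ?sqr_ge0 // sumr_ge0 // => k _; rewrite sqr_ge0.
rewrite !big_ord_recr !big_ord0 /= !add0r !mxE.
by apply/idP/idP => ?; lra.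
Qed.

Lemma SphD_inj n (q q' : 'rV[R]_2) (x x' : 'I_n -> 'rV[R]_2) : (2 <= n)%N ->
  SphD q x = SphD q' x' ->
  #|[set ij : 'I_n * 'I_n | (ij.1 < ij.2)%N & q \in Sph (x ij.1) (x ij.2)]| =
  #|[set ij : 'I_n * 'I_n | (ij.1 < ij.2)%N & q' \in Sph (x' ij.1) (x' ij.2)]|.
Proof.
move=> n_ge2 /mulIf eqD; apply/eqP; rewrite -(eqr_nat R); apply/eqP/eqD.
by rewrite invr_eq0 pnatr_eq0 -lt0n bin_gt0.
Qed.

(** The set and its mirror image have equal size, cover all pairs by totality, and meet in the
    ties. *)
Lemma card_le_pairs m (a : 'I_m -> R) :
  (2 * #|[set ij : 'I_m * 'I_m | (a ij.2 <= a ij.1)%R]| =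
   m * m + #|[set ij : 'I_m * 'I_m | a ij.1 == a ij.2]|)%N.
Proof.
set L := [set ij | _]; set E := [set ij | _ == _].
pose swap (ij : 'I_m * 'I_m) := (ij.2, ij.1).
have swap_inj : injective swap by move=> [i j] [k l] [-> ->].
pose L' := [set ij : 'I_m * 'I_m | a ij.1 <= a ij.2].
have cardL' : #|L'| = #|L|.
  rewrite -(card_imset _ swap_inj); apply: eq_card => -[i j]; rewrite !inE /=.
  apply/imsetP/idP => [[[k l]]|leij]; first by rewrite inE /= => lekl [-> ->].
  by exists (j, i); rewrite ?inE.
have := cardsUI L L'; rewrite cardL' mul2n -addnn => <-.
have -> : L :|: L' = setT by apply/setP => ij; rewrite !inE le_total.
rewrite cardsT card_prod card_ord; congr (_ + _)%N; apply: eq_card => ij.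
by rewrite !inE eq_le andbC.
Qed.

(** The ties of [a] are only the diagonal, those of [b] strictly more. *)
Lemma card_le_pairs_inj m (a b : 'I_m -> R) : injective a -> ~ injective b ->
  (#|[set ij : 'I_m * 'I_m | (a ij.2 <= a ij.1)%R]| <
   #|[set ij : 'I_m * 'I_m | (b ij.2 <= b ij.1)%R]|)%N.
Proof.
move=> inja injb; rewrite -(ltn_pmul2l (isT : 0 < 2)%N) !card_le_pairs ltn_add2l.
apply: proper_card; apply/properP; split.
  by apply/subsetP => -[i j]; rewrite !inE /= => /eqP/inja->.
have [[i j] /= /andP[/eqP eqb neq]] :
    exists ij : 'I_m * 'I_m, (b ij.1 == b ij.2) && (ij.1 != ij.2).
  apply/existsP; apply: contraT; rewrite negb_exists => /forallP nob.
  case: injb => i j eqb; apply/eqP; move: (nob (i, j)).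
  by rewrite /= eqb eqxx negbK.
exists (i, j); rewrite !inE /= ?eqb //.
by apply: contraNneq neq => /inja->.
Qed.

(* The inner products of two points of the same group, [(a_i, 1)] or [(-1, a_j)],
   are positive when [a > 0]; across groups the inner product is [a_j - a_i].
   Points of index at least [2m] lie at the origin. *)
Definition gadget (S : pzRingType) m (a : 'I_m -> S) (i k : nat) : S :=
  let a' j := oapp a 0 (insub j) in
  if (i < m)%N then (if k == 0 then a' i else 1)
  else if (i < m.*2)%N then (if k == 0 then -1 else a' (i - m)%N)
  else 0.

Definition gadget_point n m (a : 'I_m -> R) (i : 'I_n) : 'rV[R]_2 :=
  \row_k gadget a i k.

(** Pairs inside a group never count, and pairs whose larger index is at least [2m] always do; the
    latter number does not depend on [a]. *)
Lemma card_gadget n m (a : 'I_m -> R) : (m.*2 <= n)%N -> (forall i, 0 < a i) ->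
  #|[set ij : 'I_n * 'I_n | (ij.1 < ij.2)%N &
      0 \in Sph (gadget_point a ij.1) (gadget_point a ij.2)]| =
  (#|[set ij : 'I_m * 'I_m | (a ij.2 <= a ij.1)%R]| +
   #|[set ij : 'I_n * 'I_n | (ij.1 < ij.2)%N & (m.*2 <= ij.2)%N]|)%N.
Proof.
move=> le_mn a_gt0; set L := [set ij | _ <= _]; set Z := [set ij | _ < _ & _ <= _]%N.
have lt1 (i : 'I_m) : (i < n)%N by have := ltn_ord i; lia.
have lt2 (i : 'I_m) : (m + i < n)%N by have := ltn_ord i; lia.
pose f (ij : 'I_m * 'I_m) := (Ordinal (lt1 ij.1), Ordinal (lt2 ij.2)).
have f_inj : injective f.
  by move=> [i j] [k l] [/val_inj-> /addnI/val_inj->].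
have a'E (i : 'I_m) : oapp a 0 (insub (i : nat)) = a i by rewrite valK.
have a'_gt0 (k : nat) : (k < m)%N -> 0 < oapp a 0 (insub k).
  by move=> ltk; rewrite (a'E (Ordinal ltk)).
have sphE (i j : 'I_n) : (i < j)%N ->
    (0 \in Sph (gadget_point a i) (gadget_point a j)) =
    (((i, j) \in f @: L) || (m.*2 <= j)%N).
  move=> ltij; rewrite in_Sph0 !big_ord_recr big_ord0 /= add0r !mxE /gadget /=.
  have [le2j|ltj2] := leqP m.*2 j.
    have -> : (j < m)%N = false by lia.
    by rewrite !mulr0 addr0 lexx orbT.
  have neq_f k l : (i, j) = f (k, l) -> i = k :> nat /\ j = (m + l)%N :> nat.
    by move=> [-> ->].
  rewrite orbF; have [ltim|lemi] := ltnP i m; last first.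
    have -> : (j < m)%N = false by lia.
    rewrite (ltn_trans ltij ltj2) mulrN1 opprK leNgt addr_gt0 ?mulr_gt0 ?a'_gt0 //=; try lia.
    by apply/esym/negP => /imsetP[[k l] _ /neq_f[]]; have := ltn_ord k; lia.
  have [ltjm|lemj] := ltnP j m.
    rewrite mulr1 leNgt addr_gt0 ?mulr_gt0 ?a'_gt0 //=.
    by apply/esym/negP => /imsetP[[k l] _ /neq_f[_]]; lia.
  rewrite mulrN1 mul1r addrC subr_le0.
  have ltjm : (j - m < m)%N by lia.
  rewrite (a'E (Ordinal ltim)) (a'E (Ordinal ltjm)).
  apply/idP/imsetP => [leij|[[k l]]].
    exists (Ordinal ltim, Ordinal ltjm); first by rewrite inE.
    by congr pair; apply: val_inj => //=; lia.
  rewrite inE /= => lekl /neq_f[ik jl].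
  have -> : Ordinal ltim = k by apply: val_inj.
  by have -> : Ordinal ltjm = l by apply: val_inj; rewrite /= jl addKn.
rewrite -(card_imset _ f_inj) -cardsUI.
rewrite (_ : f @: L :&: Z = set0) ?cards0 ?addn0.
  apply: eq_card => -[i j]; rewrite in_setU !in_set /=; case: (ltnP i j) => ltij /=.
    by rewrite sphE.
  rewrite orbF; apply/esym/negP => /imsetP[[k l] _ [ik jl]].
  by have := ltn_ord k; move: ltij; rewrite ik jl /=; lia.
apply/setP => -[i j]; rewrite !inE; apply/negP => /and3P[/imsetP[[k l] _ [_ ->]] _ /=].
by have := ltn_ord l; lia.
Qed.

(** The gadget over the polynomial ring, with the variables as [a]; its entries are 0, 1, -1 or
    variables, hence of degree at most one. *)
Definition gadget_coords n m : ((1 + n) * 2).-tuple {mpoly R[m]} :=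
  [tuple mxvec (col_mx 0 (\matrix_(i < n, k < 2) gadget (fun j => 'X_j) i k)) 0 l
    | l < (1 + n) * 2].

Lemma gadget_coordsE n m (a : 'I_m -> R) l :
  (tnth (gadget_coords n m) l).@[a] = input_coords 0 (@gadget_point n m a) l.
Proof.
rewrite tnth_mktuple /input_coords.
case/mxvec_indexP: l => i k; rewrite !mxvecE.
case: (splitP i) => [i0|j] eqi.
  have -> : i = lshift n i0 by apply: val_inj.
  by rewrite !col_mxEu !mxE meval0.
have -> : i = rshift 1 j by apply: val_inj.
rewrite !col_mxEd !mxE /gadget.
have evalX (d : nat) : (oapp (fun j => 'X_j) 0 (insub d)).@[a] = oapp a 0 (insub d).
  by case: insubP => [x _ _|_] /=; rewrite ?mevalXU ?meval0.
by do 3?[case: ifP => _]; rewrite ?meval0 ?mevalN ?meval1 ?evalX.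
Qed.

Lemma msize_gadget_coords n m l : (msize (tnth (gadget_coords n m) l) <= 2)%N.
Proof.
rewrite tnth_mktuple; case/mxvec_indexP: l => i k; rewrite mxvecE.
case: (splitP i) => [i0|j] eqi.
  have -> : i = lshift n i0 by apply: val_inj.
  by rewrite !col_mxEu !mxE msize0.
have -> : i = rshift 1 j by apply: val_inj.
rewrite !col_mxEd !mxE /gadget.
have szX (d : nat) : (msize (oapp (fun j => 'X_j) 0%R (insub d) : {mpoly R[m]}) <= 2)%N.
  by case: insubP => [x _ _|_] /=; rewrite ?mmeasureX /= ?mdeg1 ?msize0.
have sz1 : (msize (1%R : {mpoly R[m]}) <= 2)%N by rewrite msizeC oner_eq0.
by do 3?[case: ifP => _]; rewrite ?msize0 ?msizeN.
Qed.

(** Restricted to gadgets, the tree separates injective from non-injective [a]. For odd [n] one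
    point is left over at the origin. *)
Lemma fact_le_SphD_tree D n (T : adtree R ((1 + n) * 2)) :
  (0 < D)%N -> (2 <= n)%N -> adtree_degree_le D T ->
  (forall q x, adtree_eval T (input_coords q x) = SphD q x) ->
  (n./2`! <= 3 ^ adtree_depth T * 'C(n./2 + D * adtree_depth T, n./2))%N.
Proof.
move=> D_gt0 n_ge2 degT evalT; set m := n./2.
pose T' := adtree_comp (gadget_coords n m) T.
have evalT' a : adtree_eval T' a = SphD 0 (@gadget_point n m a).
  rewrite adtree_eval_comp -evalT; apply: eq_adtree_eval => l.
  exact: gadget_coordsE.
rewrite -(adtree_depth_comp (gadget_coords n m) T).
apply: (fact_le_distinctness_tree D_gt0).
  by apply: adtree_degree_comp => // l; apply: msize_gadget_coords.
have le2m : (m.*2 <= n)%N by rewrite /m; lia.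
move=> a b a_gt0 b_gt0 inja injb; rewrite !evalT' => /(SphD_inj n_ge2).
rewrite !card_gadget // => /addIn eqab.
by have := card_le_pairs_inj inja injb; rewrite eqab ltnn.
Qed.

End Geometry.

(** * Asymptotic estimate and conclusion *)

Lemma expn_le_fact k m : (2 * k <= m -> k ^ k <= m`!)%N.
Proof.
move=> lekm; apply: leq_trans (leq_fact lekm); rewrite mul2n -addnn.
suff lej j : (k ^ j <= (k + j)`!)%N by [].
elim: j => [|j IHj]; first by rewrite fact_gt0.
by rewrite addnS factS expnS leq_mul // -addnS leq_addr.
Qed.

Theorem theorem3p1 (R : realType) (D : nat) (hD : (1 <= D)%N) :
  exists c : R, 0 < c /\
    exists N : nat, forall n : nat, (N <= n)%N ->
      forall T : adtree R ((1 + n) * 2),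
        adtree_degree_le D T ->
        (forall (q : 'rV[R]_2) (x : 'I_n -> 'rV[R]_2),
            adtree_eval T (input_coords q x) = SphD q x) ->
        c * n%:R * ln n%:R <= (adtree_depth T)%:R.
Proof.
exists (16 * (D.+2)%:R)^-1; split; first by rewrite invr_gt0 mulr_gt0 ?ltr0n.
exists (2 ^ 16)%N => n n_ge T degT evalT; set h := adtree_depth T.
have n_ge8 : (8 <= n)%N by apply: leq_trans n_ge; rewrite (@leq_exp2l 2 3).
set m := n./2; pose k := m./2.
have km : (2 * k <= m)%N by rewrite /k; lia.
have mn : (2 * m <= n)%N by rewrite /m; lia.
have nk : (n <= 8 * k)%N by rewrite /k /m; lia.
have k_gt0 : (0 < k)%N by lia.
(* Bounding 3 by [2 ^ 2] and the binomial by [2 ^ (m + D * h)] gives the factor [D.+2]. *)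
have bound_nat : (k ^ k <= 2 ^ (m + D.+2 * h))%N.
  apply: leq_trans (expn_le_fact km) _.
  apply: leq_trans (fact_le_SphD_tree hD _ degT evalT) _; first lia.
  apply: leq_trans (leq_mul (leqnn _) (leq_bin_exp2 _ _)) _.
  apply: leq_trans (_ : 4 ^ h * 2 ^ (m + D * h) <= _)%N.
    by rewrite -/h leq_mul //; case: (posnP h) => [->|h_gt0] //; rewrite leq_exp2r.
  rewrite -/h -[4%N]/(2 ^ 2)%N -expnM -expnD leq_exp2l //; lia.
have n_gt0 : (0 < n)%N by lia.
have kR_gt0 : (0 : R) < k%:R by rewrite ltr0n.
have ln2_gt0 : (0 : R) < ln 2 by rewrite ln_gt0 // ltr1n.
have ln2_le1 : ln 2 <= 1 :> R.
  by have := @le_ln1Dx R 1; rewrite (_ : 1 + 1 = 2) //; apply; lra.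
have bound : k%:R * ln k%:R <= (m%:R + D.+2%:R * h%:R) * ln 2 :> R.
  rewrite -natrM -natrD ![_%:R * _]mulr_natl -!lnXn ?ltr0n // -!natrX.
  by rewrite ler_ln ?posrE ?ltr0n ?expn_gt0 ?k_gt0 // ler_nat.
have lnn_ge : 16 * ln 2 <= ln n%:R :> R.
  rewrite [_ * _]mulr_natl -lnXn ?ltr0n // -natrX.
  by rewrite ler_ln ?ler_nat ?posrE ?ltr0n ?expn_gt0 ?n_gt0.
have lnk_ge : ln n%:R - 3 * ln 2 <= ln k%:R :> R.
  rewrite lerBlDr addrC [_ * ln 2]mulr_natl -lnXn ?ltr0n // -natrX.
  rewrite -lnM ?posrE ?ltr0n ?expn_gt0 //.
  by rewrite -natrM ler_ln ?posrE ?ltr0n ?muln_gt0 ?expn_gt0 ?k_gt0 // ?ler_nat //; lia.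
have kR_ge : n%:R <= 8 * k%:R :> R by rewrite -natrM ler_nat.
have mR_le : 2 * m%:R <= n%:R :> R by rewrite -natrM ler_nat.
rewrite -mulrA ler_pdivrMl ?mulr_gt0 ?ltr0n //.
have Dh_ge0 : (0 : R) <= D.+2%:R * h%:R by rewrite mulr_ge0 ?ler0n.
(* With [n <= 8k] and [2m <= n] this yields [n ln n <= 7 n ln 2 + 8 (D+2) h]. As [n >= 2^16], the
   first term is at most [7/16] of [n ln n], so the constant 16 suffices. *)
have : n%:R * (ln n%:R - 3 * ln 2) <= 8 * (k%:R * ln k%:R) :> R.
  rewrite [leRHS]mulrA; apply: ler_pM => //; lra.
have : m%:R * ln 2 <= n%:R * ln 2 / 2 :> R by nra.
have : n%:R * (16 * ln 2) <= n%:R * ln n%:R :> R by rewrite ler_pM2l // ltr0n.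
have : D.+2%:R * h%:R * ln 2 <= D.+2%:R * h%:R :> R by rewrite ler_piMr.
rewrite -/h; lra.
Qed.
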